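(* Let $\mathbf{x}^*$ be an optimal solution of the linear program $\min_{\mathbf{x}}\ \mathbf{c}^T\mathbf{x}$ s.t. $\mathbf{A}\mathbf{x}\le\mathbf{b}$, and let $(\hat{\mathbf{x}},\hat{\mathbf{y}})$ be a primal-dual pair satisfying the KKT conditions for the quadratic program $\min_{\mathbf{x}}\ \mathbf{c}^T\mathbf{x}+\frac{1}{2\gamma}\mathbf{x}^T\mathbf{W}\mathbf{x}$ s.t. $\mathbf{A}\mathbf{x}\le\mathbf{b}$. Set $\hat{\mathbf{p}}=\frac1\gamma\mathbf{W}\hat{\mathbf{x}}$ and let $\tilde{\mathbf{x}}$ be an optimal solution to $$\max_{\mathbf{x}}\ \hat{\mathbf{p}}^T\mathbf{x}\quad\text{s.t. }\ \mathbf{c}^T\mathbf{x}\le\mathbf{c}^T\hat{\mathbf{x}},\quad \mathbf{x}\in\mathcal{B},$$ where $\mathcal{B}$ is any set that contains $\mathbf{x}^*$ (encoding a subset of constraints known to be satisfied by $\mathbf{x}^*$, so that the problem is a linear program). Then $$-\mathbf{b}^T\hat{\mathbf{y}}-\hat{\mathbf{p}}^T\tilde{\mathbf{x}}\le\mathbf{c}^T\mathbf{x}^*.$$ Furthermore, if $\mathbf{x}^*=\hat{\mathbf{x}}=\tilde{\mathbf{x}}$, then this bound is tight, i.e. holds with equality.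
   Context: Here $\mathbf{A}$ is a real $M\times N$ matrix, $\mathbf{b}\in\mathbb{R}^M$, $\mathbf{c}\in\mathbb{R}^N$, $\gamma>0$, and $\mathbf{W}$ is an $N\times N$ diagonal matrix with positive diagonal entries. The KKT conditions for the quadratic program are: (1) $\mathbf{A}\hat{\mathbf{x}}\le\mathbf{b}$; (2) $\hat{\mathbf{y}}^T(\mathbf{A}\hat{\mathbf{x}}-\mathbf{b})=0$; (3) $\frac1\gamma\mathbf{W}\hat{\mathbf{x}}=-\mathbf{A}^T\hat{\mathbf{y}}-\mathbf{c}$; (4) $\hat{\mathbf{y}}\ge 0$, where $\hat{\mathbf y}\in\mathbb{R}^M$. *)

(* Defs.v *)
From HB Require Import structures.
From mathcomp Require Import all_boot all_order all_algebra.
From mathcomp Require Import classical_sets reals.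

Set Implicit Arguments.
Unset Strict Implicit.
Unset Printing Implicit Defensive.

Import Order.TTheory GRing.Theory Num.Theory.
Local Open Scope classical_set_scope.
Local Open Scope ring_scope.

(* The scalar u^T v; [u^T *m v] itself is a 1 x 1 matrix. *)
Definition dot (R : realType) (n : nat) (u v : 'cV[R]_n) : R :=
  (u^T *m v) 0 0.

Definition le_vec (R : realType) (n : nat) (u v : 'cV[R]_n) : Prop :=
  forall i : 'I_n, u i 0 <= v i 0.

Definition optimal_min (R : realType) (T : Type) (D : set T) (f : T -> R)
    (x : T) : Prop :=
  D x /\ forall z : T, D z -> f x <= f z.

Definition optimal_max (R : realType) (T : Type) (D : set T) (f : T -> R)
    (x : T) : Prop :=
  D x /\ forall z : T, D z -> f z <= f x.

Definition polyhedron (R : realType) (m n : nat) (A : 'M[R]_(m, n))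
    (b : 'cV[R]_m) : set 'cV[R]_n :=
  [set x | le_vec (A *m x) b].

(* KKT conditions of
     min_x  c^T x + (1 / (2 gamma)) x^T W x   s.t.  A x <= b,
   where y is the vector of multipliers of the constraints A x <= b: primal
   feasibility, complementary slackness, stationarity, dual feasibility. *)
Record kkt (R : realType) (m n : nat) (A : 'M[R]_(m, n)) (b : 'cV[R]_m)
    (c : 'cV[R]_n) (gamma : R) (W : 'M[R]_n) (x : 'cV[R]_n) (y : 'cV[R]_m)
    : Prop := KKT {
  kkt_primal : le_vec (A *m x) b;
  kkt_slack : dot y (A *m x - b) = 0;
  kkt_stationary : gamma^-1 *: (W *m x) = - (A^T *m y) - c;
  kkt_dual : le_vec 0 y
}.

(* Main.v *)
Require Import Defs.
From HB Require Import structures.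
From mathcomp Require Import all_boot all_order all_algebra.
From mathcomp Require Import classical_sets reals.

(** Stationarity says that the linear cost splits as [c = - A^T yhat - phat], so
    for every [x]

      [c^T x = - yhat^T (A x) - phat^T x]

    (lemma [kkt_cost_split]). At [x = xstar] each of the two terms is bounded
    below separately. Feasibility of [xstar] and [yhat >= 0] give
    [yhat^T (A xstar) <= b^T yhat], which is weak duality. For the other term,
    [xstar] is a competitor in the problem defining [xtilde]: it lies in [B],
    and [c^T xstar <= c^T xhat] because [xhat] is feasible for the linear
    program. Hence [phat^T xstar <= phat^T xtilde].

    When the three points coincide, the first inequality is an equality by
    complementary slackness and the second trivially. *)

Set Implicit Arguments.
Unset Strict Implicit.
Unset Printing Implicit Defensive.

Import Order.TTheory GRing.Theory Num.Theory.
Local Open Scope classical_set_scope.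
Local Open Scope ring_scope.

Lemma dotC (R : realType) (n : nat) (u v : 'cV[R]_n) : dot u v = dot v u.
Proof. by rewrite /dot !mxE; apply: eq_bigr => i _; rewrite !mxE mulrC. Qed.

Lemma dotNl (R : realType) (n : nat) (u v : 'cV[R]_n) :
  dot (- u) v = - dot u v.
Proof. by rewrite /dot linearN mulNmx mxE. Qed.

Lemma dotBl (R : realType) (n : nat) (u v w : 'cV[R]_n) :
  dot (u - v) w = dot u w - dot v w.
Proof. by rewrite /dot linearB mulmxBl !mxE. Qed.

Lemma dotBr (R : realType) (n : nat) (u v w : 'cV[R]_n) :
  dot u (v - w) = dot u v - dot u w.
Proof. by rewrite dotC dotBl !(dotC u). Qed.

Lemma dot_trmxl (R : realType) (m n : nat) (A : 'M[R]_(m, n))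
    (y : 'cV[R]_m) (x : 'cV[R]_n) : dot (A^T *m y) x = dot y (A *m x).
Proof. by rewrite /dot trmx_mul trmxK mulmxA. Qed.

Lemma ler_dot (R : realType) (n : nat) (y u v : 'cV[R]_n) :
  le_vec 0 y -> le_vec u v -> dot y u <= dot y v.
Proof.
move=> y_ge0 le_uv; rewrite /dot !mxE; apply: ler_sum => i _.
by rewrite !mxE ler_wpM2l //; have := y_ge0 i; rewrite mxE.
Qed.

(** Stationarity paired with [x]. The point [x] is arbitrary, so the cost of
    [xstar] can be read off from multipliers that belong to [xhat]. *)
Lemma kkt_cost_split (R : realType) (m n : nat) (A : 'M[R]_(m, n))
    (b : 'cV[R]_m) (c : 'cV[R]_n) (gamma : R) (W : 'M[R]_n)
    (xhat : 'cV[R]_n) (yhat : 'cV[R]_m) (x : 'cV[R]_n) :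
  kkt A b c gamma W xhat yhat ->
  dot c x = - dot yhat (A *m x) - dot (gamma^-1 *: (W *m xhat)) x.
Proof.
by case=> _ _ -> _; rewrite dotBl dotNl dot_trmxl opprB addrCA subrr addr0.
Qed.

Lemma kkt_slack_eq (R : realType) (m n : nat) (A : 'M[R]_(m, n))
    (b : 'cV[R]_m) (c : 'cV[R]_n) (gamma : R) (W : 'M[R]_n)
    (xhat : 'cV[R]_n) (yhat : 'cV[R]_m) :
  kkt A b c gamma W xhat yhat -> dot yhat (A *m xhat) = dot b yhat.
Proof.
by move/kkt_slack/eqP; rewrite dotBr subr_eq0 => /eqP ->; rewrite dotC.
Qed.

Theorem theorem5 (R : realType) (M N : nat)
    (A : 'M[R]_(M, N)) (b : 'cV[R]_M) (c : 'cV[R]_N)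
    (gamma : R) (gamma_gt0 : 0 < gamma)
    (W : 'M[R]_N) (W_diag : is_diag_mx W) (W_gt0 : forall i : 'I_N, 0 < W i i)
    (xstar : 'cV[R]_N)
    (xstar_opt : optimal_min (polyhedron A b) (fun x => dot c x) xstar)
    (xhat : 'cV[R]_N) (yhat : 'cV[R]_M)
    (xyhat_kkt : kkt A b c gamma W xhat yhat)
    (phat : 'cV[R]_N) (phat_def : phat = gamma^-1 *: (W *m xhat))
    (B : set 'cV[R]_N) (xstar_B : B xstar)
    (xtilde : 'cV[R]_N)
    (xtilde_opt :
       optimal_max [set x | dot c x <= dot c xhat /\ B x]
                   (fun x => dot phat x) xtilde) :
  - dot b yhat - dot phat xtilde <= dot c xstar /\
  (xstar = xhat -> xhat = xtilde ->
   - dot b yhat - dot phat xtilde = dot c xstar).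
Proof.
have [xstar_feas xstar_min] := xstar_opt.
have [_ xtilde_max] := xtilde_opt.
have cost x : dot c x = - dot yhat (A *m x) - dot phat x.
  by rewrite phat_def; exact: kkt_cost_split xyhat_kkt.
split=> [|eq_star_hat eq_hat_tilde].
  have weak_duality : dot yhat (A *m xstar) <= dot b yhat.
    by rewrite (dotC b); apply: ler_dot (kkt_dual xyhat_kkt) xstar_feas.
  have xstar_competes : dot phat xstar <= dot phat xtilde.
    apply: xtilde_max; split=> //.
    exact: xstar_min (kkt_primal xyhat_kkt).
  by rewrite cost lerB // lerN2.
by rewrite cost -eq_hat_tilde eq_star_hat (kkt_slack_eq xyhat_kkt).
Qed.
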